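(* Let $u^*$ be an optimal solution of $(D)$ and let $kl\in B$. Then $r_{kl}(u^* )=R_{kl}$ (the reduced cost is exact) if and only if there exists a feasible solution of $(P_{|kl})$ that satisfies the $kl$-excluded complementary slackness conditions with $u^*$.
   Context: Setting. $X_1,\dots,X_n$ are variables with finite domains $D(X_i)\subset\mathbb{Z}$, and $C$ is a constraint on them, i.e. a set of allowed tuples. A support for $C$ is an allowed tuple $\langle a_1,\dots,a_n\rangle$ with $a_i\in D(X_i)$ for all $i$. $B=\{ij : 1\le i\le n,\ j\in D(X_i)\}$ is the (finite) set of variable/value pairs, where $ij$ is short for $(i,j)$. The characteristic vector of a support is $x\in\{0,1\}^{B}$ with $x_{ij}=1$ iff $a_i=j$; $\mathcal{S}$ is the set of characteristic vectors of the supports of $C$. Each pair has a cost $c_{ij}\in\mathbb{Z}$. Ideal formulation (standing assumption): $A$ is a real $m\times|B|$ matrix (with columns $A_{ij}$, $ij\in B$, and rows $A^{\intercal}_1,\dots,A^{\intercal}_m$) and $b\in\mathbb{R}^m$ are such that $\{x\in\mathbb{R}^{B}_+ : Ax\ge b\}=\mathrm{conv}(\mathcal{S})$. $(P)$: $z^*=\min\{cx : Ax\ge b,\ x\in\mathbb{R}^B_+\}$; $(D)$: $\max\{ub : uA\le c,\ u\in\mathbb{R}^m_+\}$. For $kl\in B$, $(P_{|kl})$ is $(P)$ with the additional constraint $x_{kl}=1$, with optimal value $z^*_{|kl}$. Feasibility (standing assumption): every pair of $B$ belongs to at least one support of $C$; hence $(P)$, $(D)$ and all $(P_{|kl})$ are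 feasible and bounded. For feasible $u$ of $(D)$ the reduced cost of $kl$ is $r_{kl}(u)=c_{kl}-uA_{kl}$. $R_{kl}=z^*_{|kl}-z^*$. $kl$-excluded complementary slackness conditions for $x$ (feasible for $(P)$) and $u$ (feasible for $(D)$): for every $ij\in B\setminus\{kl\}$, $uA_{ij}=c_{ij}$ or $x_{ij}=0$; and for every $1\le p\le m$, $A^{\intercal}_p x=b_p$ or $u_p=0$. *)

(* Defs.v *)
From mathcomp Require Export all_boot all_order all_algebra.
From mathcomp Require Export finmap.
From mathcomp Require Export boolp classical_sets reals convex.

Set Implicit Arguments.
Unset Strict Implicit.
Unset Printing Implicit Defensive.

Import Order.TTheory GRing.Theory Num.Theory.

Local Open Scope classical_set_scope.
Local Open Scope ring_scope.

(* The set B of variable/value pairs: ij is the dependent pair of a variable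
   i and an element j of its domain. Vectors of R^B are matrices indexed by
   'I_#|B|; the coordinate of ij is [enum_rank ij]. *)
Definition vvpair (n : nat) (D : 'I_n -> {fset int}) : finType :=
  {i : 'I_n & D i}.

Definition pvar (n : nat) (D : 'I_n -> {fset int}) (ij : vvpair D) : 'I_n :=
  tag ij.

Definition pval (n : nat) (D : 'I_n -> {fset int}) (ij : vvpair D) : int :=
  val (tagged ij).

Definition supports (n : nat) (D : 'I_n -> {fset int})
    (C : set (n.-tuple int)) : set (n.-tuple int) :=
  [set a | C a /\ forall i, tnth a i \in D i].

Definition char_vec (R : realType) (n : nat) (D : 'I_n -> {fset int})
    (a : n.-tuple int) : 'cV[R]_#|vvpair D| :=
  \col_j (tnth a (pvar (enum_val j)) == pval (enum_val j))%:R.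

Definition char_vecs (R : realType) (n : nat) (D : 'I_n -> {fset int})
    (C : set (n.-tuple int)) : set 'cV[R]_#|vvpair D| :=
  char_vec R D @` supports D C.
Arguments char_vecs R {n} D C.

Definition cost_vec (R : realType) (n : nat) (D : 'I_n -> {fset int})
    (c : vvpair D -> int) : 'rV[R]_#|vvpair D| :=
  \row_j (c (enum_val j))%:~R.

Definition convex_hull (R : realType) (V : lmodType R) (X : set V) : set V :=
  smallest (@convex_set R V) X.

Definition mxle (R : realType) (p q : nat) (M N : 'M[R]_(p, q)) : Prop :=
  forall i j, M i j <= N i j.

Definition primal_feasible (R : realType) (m d : nat) (A : 'M[R]_(m, d))
    (b : 'cV[R]_m) : set 'cV[R]_d :=
  [set x | mxle b (A *m x) /\ mxle 0 x].

Definition primal_feasible_at (R : realType) (m d : nat) (A : 'M[R]_(m, d))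
    (b : 'cV[R]_m) (k : 'I_d) : set 'cV[R]_d :=
  [set x | primal_feasible A b x /\ x k 0 = 1].

Definition dual_feasible (R : realType) (m d : nat) (A : 'M[R]_(m, d))
    (c : 'rV[R]_d) : set 'rV[R]_m :=
  [set u | mxle (u *m A) c /\ mxle 0 u].

Definition dual_optimal (R : realType) (m d : nat) (A : 'M[R]_(m, d))
    (b : 'cV[R]_m) (c : 'rV[R]_d) (u : 'rV[R]_m) : Prop :=
  dual_feasible A c u /\
  forall v, dual_feasible A c v -> (v *m b) 0 0 <= (u *m b) 0 0.

(* The least value of [c *m x] for x in X, as an attained minimum; the default
   0 is returned only when there is no minimum. *)
Definition min_cost (R : realType) (d : nat) (c : 'rV[R]_d)
    (X : set 'cV[R]_d) : R :=
  let values := [set (c *m x) 0 0 | x in X] in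
  xget 0 (values `&` lbound values).

Definition reduced_cost (R : realType) (m d : nat) (A : 'M[R]_(m, d))
    (c : 'rV[R]_d) (u : 'rV[R]_m) (k : 'I_d) : R :=
  c 0 k - (u *m col k A) 0 0.

Definition exact_reduced_cost (R : realType) (m d : nat) (A : 'M[R]_(m, d))
    (b : 'cV[R]_m) (c : 'rV[R]_d) (k : 'I_d) : R :=
  min_cost c (primal_feasible_at A b k) - min_cost c (primal_feasible A b).

Definition excluded_slackness (R : realType) (m d : nat) (A : 'M[R]_(m, d))
    (b : 'cV[R]_m) (c : 'rV[R]_d) (k : 'I_d)
    (x : 'cV[R]_d) (u : 'rV[R]_m) : Prop :=
  (forall j, j != k -> (u *m col j A) 0 0 = c 0 j \/ x j 0 = 0) /\
  (forall p, (row p A *m x) 0 0 = b p 0 \/ u 0 p = 0).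

(* Main.v *)
(** For [u] dual feasible and [x] feasible for [P_|kl], the quantity
    [c x - u b - r_kl(u)] is the sum of the nonnegative terms
    [(c_ij - u A_ij) x_ij] (for [ij] distinct from [kl]) and
    [u_p (A_p x - b_p)], so it vanishes exactly when the kl-excluded
    complementary slackness conditions hold. Strong duality, obtained from
    Farkas' lemma, gives [u b = z*] when [u] is optimal. The minima of [P] and
    [P_|kl] are attained: both feasible sets are faces of the convex hull of
    the finite set of characteristic vectors. *)
Require Import Defs.
From mathcomp Require Import interval_inference.

Set Implicit Arguments.
Unset Strict Implicit.
Unset Printing Implicit Defensive.

Import Order.TTheory GRing.Theory Num.Theory.

Local Open Scope classical_set_scope.
Local Open Scope ring_scope.

(** * Linear programming duality *)

Lemma mulmx_ge0 (R : realType) (p q r : nat) (M : 'M[R]_(p, q))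
    (N : 'M[R]_(q, r)) : mxle 0 M -> mxle 0 N -> mxle 0 (M *m N).
Proof.
move=> M0 N0 i j; rewrite !mxE; apply: sumr_ge0 => k _.
by apply: mulr_ge0; [have := M0 i k|have := N0 k j]; rewrite mxE.
Qed.

Lemma mxle_subr0 (R : realType) (p q : nat) (M N : 'M[R]_(p, q)) :
  mxle 0 (M - N) <-> mxle N M.
Proof.
by split=> le i j; have := le i j; rewrite !mxE subr_ge0.
Qed.

Lemma mxle_col_mx0 (R : realType) (p1 p2 q : nat) (M : 'M[R]_(p1, q))
    (N : 'M[R]_(p2, q)) : mxle 0 (col_mx M N) <-> mxle 0 M /\ mxle 0 N.
Proof.
split=> [le|[leM leN] i j].
  split=> i j; first by have := le (lshift _ i) j; rewrite col_mxEu !mxE.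
  by have := le (rshift _ i) j; rewrite col_mxEd !mxE.
rewrite -[i]splitK; case: (split i) => l /=.
  by rewrite col_mxEu mxE; have := leM l j; rewrite mxE.
by rewrite col_mxEd mxE; have := leN l j; rewrite mxE.
Qed.

Lemma mxle_row_mx0 (R : realType) (p q1 q2 : nat) (M : 'M[R]_(p, q1))
    (N : 'M[R]_(p, q2)) : mxle 0 (row_mx M N) <-> mxle 0 M /\ mxle 0 N.
Proof.
split=> [le|[leM leN] i j].
  split=> i j; first by have := le i (lshift _ j); rewrite row_mxEl !mxE.
  by have := le i (rshift _ j); rewrite row_mxEr !mxE.
rewrite -[j]splitK; case: (split j) => l /=.
  by rewrite row_mxEl mxE; have := leM i l; rewrite mxE.
by rewrite row_mxEr mxE; have := leN i l; rewrite mxE.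
Qed.

Lemma mxle11 (R : realType) (M N : 'M[R]_1) : mxle M N <-> M 0 0 <= N 0 0.
Proof. by split=> // le i j; rewrite !ord1. Qed.

(* Bartl's induction on the number of rows: if the first row [g] cannot be
   dropped, then some [x0] violates the implication without [g], and the other
   rows are restricted to the kernel of [g] by projecting along [x0]. *)
Lemma farkas (R : realType) (k d : nat) (G : 'M[R]_(k, d)) (c : 'rV[R]_d) :
  (forall x : 'cV[R]_d, mxle 0 (G *m x) -> 0 <= (c *m x) 0 0) ->
  exists2 y : 'rV[R]_k, mxle 0 y & y *m G = c.
Proof.
elim: k G c => [|k IHk] G c imp.
  exists 0; first by move=> i [].
  have ge0 (x : 'cV_d) : 0 <= (c *m x) 0 0 by apply: imp => -[].
  rewrite mul0mx; apply/rowP=> j; rewrite mxE; apply: le_anti.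
  (* Testing each basis vector with both signs forces [c = 0]. *)
  have := ge0 (delta_mx j 0); have := ge0 (- delta_mx j 0).
  by rewrite mulmxN -colE !mxE oppr_ge0 => -> ->.
rewrite -[k.+1]/(1 + k)%N in G imp *.
rewrite -[G]vsubmxK in imp *.
set g := usubmx G in imp *; set G' := dsubmx G in imp *.
have [imp'|] := pselect (forall x : 'cV_d, mxle 0 (G' *m x) -> 0 <= (c *m x) 0 0).
  have [y y0 yG] := IHk _ _ imp'.
  exists (row_mx 0 y); first by apply/mxle_row_mx0; split=> // i j.
  by rewrite mul_row_col mul0mx add0r.
move/existsNP=> [x0 /not_implyP[G'x0 /negP]]; rewrite -ltNge => cx0.
set s := (g *m x0) 0 0.
have s0 : s < 0.
  rewrite ltNge; apply/negP => s0; move: cx0; rewrite ltNge imp//.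
  by rewrite mul_col_mx; apply/mxle_col_mx0; split=> //; apply/mxle11; rewrite mxE.
pose P := 1%:M - s^-1 *: (x0 *m g).
have gP : g *m P = 0.
  rewrite mulmxBr mulmx1 -scalemxAr mulmxA [g *m x0]mx11_scalar -/s.
  by rewrite mul_scalar_mx scalerA mulVf ?lt_eqF// scale1r subrr.
have [|y y0 yG] := IHk (G' *m P) (c *m P).
  move=> x G'Px; rewrite -mulmxA; apply: imp.
  rewrite mul_col_mx; apply/mxle_col_mx0; split; last by rewrite mulmxA.
  by rewrite mulmxA gP mul0mx => i j.
(* [c - y *m G'] vanishes on the kernel of [g], so it is a multiple of [g]. Evaluation at [x0]
   yields the factor [t], nonnegative since [c x0 < 0 <= y G' x0] and [s < 0]. *)
pose t := s^-1 * ((c - y *m G') *m x0) 0 0.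
have t0 : 0 <= t.
  rewrite mulr_le0 ?invr_le0 ?(ltW s0)// mulmxBl !mxE.
  have := mulmx_ge0 y0 G'x0 0 0; rewrite mulmxA [X in X <= _]mxE => le0.
  have: (c *m x0) 0 0 - (y *m G' *m x0) 0 0 <= 0 by rewrite subr_le0 (le_trans (ltW cx0)).
  by rewrite !mxE.
exists (row_mx t%:M y).
  by apply/mxle_row_mx0; split=> //; apply/mxle11; rewrite !mxE eqxx.
rewrite mul_row_col mul_scalar_mx.
have : (c - y *m G') *m P = 0 by rewrite mulmxBl -yG mulmxA subrr.
rewrite /P mulmxBr mulmx1 -scalemxAr mulmxA.
rewrite [(c - y *m G') *m x0]mx11_scalar mul_scalar_mx scalerA -/t.
by move/eqP; rewrite subr_eq0 => /eqP <-; rewrite subrK.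
Qed.

(* Farkas' lemma is applied to the homogenized program in [(x, s)], with [s]
   the scale: [A x - s b >= 0], [x >= 0] and [s >= 0] imply [c x - z s >= 0]. *)
Lemma strong_duality (R : realType) (m d : nat) (A : 'M[R]_(m, d))
    (b : 'cV[R]_m) (c : 'rV[R]_d) (z : R) (x0 : 'cV[R]_d) :
  primal_feasible A b x0 ->
  (forall x, primal_feasible A b x -> z <= (c *m x) 0 0) ->
  exists2 v, dual_feasible A c v & z <= (v *m b) 0 0.
Proof.
move=> [Ax0 x00] zle.
(* The identity block encodes [x >= 0] and [s >= 0]; its multipliers become the slacks of [v A <= c]
   and [z <= v b]. *)
have [|y] := @farkas R _ _ (col_mx (row_mx A (- b)) 1%:M) (row_mx c (- z%:M)).
  move=> x; rewrite mul_col_mx mul1mx -[x]vsubmxK.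
  set x1 := usubmx x; set s := dsubmx x.
  rewrite !mul_row_col !mulNmx => /mxle_col_mx0[/mxle_subr0 Ax1].
  move=> /mxle_col_mx0[x10 /mxle11]; rewrite mxE => s0.
  move: Ax1; rewrite [s]mx11_scalar mul_mx_scalar mul_scalar_mx.
  set t := s 0 0 in s0 *; rewrite !mxE eqxx mulr1n -/t => Ax1.
  have -> : \sum_j c 0 j * x1 j 0 = (c *m x1) 0 0 by rewrite mxE.
  rewrite subr_ge0 mulrC.
  have [t0|] := ltP 0 t.
    have : z <= (c *m (t^-1 *: x1)) 0 0.
      apply: zle; split=> i j.
        rewrite -scalemxAr !mxE ler_pdivlMl//.
        by have := Ax1 i j; rewrite !mxE.
      by have := x10 i j; rewrite !mxE; apply: mulr_ge0; rewrite invr_ge0 ltW.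
    by rewrite -scalemxAr mxE ler_pdivlMl// mulrC.
  (* At scale 0, [x1] is a recession direction: a negative cost would push the objective below [z]
     along the ray from [x0]. *)
  move=> /(conj s0)/andP/le_anti t0; rewrite -t0 in Ax1 *.
  rewrite mul0r leNgt; apply/negP => cx1.
  have ray r : 0 <= r -> z <= (c *m x0) 0 0 + r * (c *m x1) 0 0.
    move=> r0; have : z <= (c *m (x0 + r *: x1)) 0 0.
      apply: zle; split=> i j.
        rewrite mulmxDr -scalemxAr mxE [X in _ + X]mxE.
        apply: ler_wpDr (Ax0 i j); apply: mulr_ge0 => //.
        by have := Ax1 i j; rewrite scale0r mxE.
      have := x00 i j; have := x10 i j; rewrite !mxE => x1ij x0ij.
      by apply: addr_ge0 => //; apply: mulr_ge0.
    by rewrite mulmxDr -scalemxAr mxE [X in _ + X]mxE.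
  have gap : 0 <= (c *m x0) 0 0 - z by rewrite subr_ge0 zle.
  (* This step length brings the cost on the ray down to [z - 1]. *)
  have := ray (((c *m x0) 0 0 - z + 1) / - (c *m x1) 0 0).
  rewrite divr_ge0 ?(ler_wpDr _ gap)// ?oppr_ge0 ?(ltW cx1)// => /(_ isT).
  rewrite invrN mulrN mulNr divfK ?lt_eqF// opprD opprB.
  by rewrite addrA addrCA subrr addr0 lerBrDr gerDl ler10.
rewrite -[y]hsubmxK; set v := lsubmx y; set w := rsubmx y.
rewrite mul_row_col mul_mx_row mulmx1 -[w]hsubmxK add_row_mx.
move=> /mxle_row_mx0[v0 /mxle_row_mx0[w1 w2]] /eq_row_mx[vA vb].
exists v; first split=> //.
  apply/mxle_subr0; rewrite -vA addrAC subrr add0r; exact: w1.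
have := congr1 (fun M : 'M[R]_1 => M 0 0) vb.
rewrite mulmxN !mxE eqxx mulr1n => e; rewrite -lerN2 -e lerDl.
by have /mxle11 := w2; rewrite !mxE.
Qed.

(** With column [k] put back among the others, the right-hand side is [(c - u A) x + u (A x - b)],
    where [u A x] cancels. *)
Lemma duality_gap (R : realType) (m d : nat) (A : 'M[R]_(m, d))
    (b : 'cV[R]_m) (c : 'rV[R]_d) (k : 'I_d) (x : 'cV[R]_d) (u : 'rV[R]_m) :
  (c *m x) 0 0 - (u *m b) 0 0 = reduced_cost A c u k * x k 0
    + (\sum_(j | j != k) (c 0 j - (u *m col j A) 0 0) * x j 0
       + \sum_p u 0 p * ((row p A *m x) 0 0 - b p 0)).
Proof.
rewrite addrA -(bigD1 k (P := predT))//=.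
have -> : \sum_j (c 0 j - (u *m col j A) 0 0) * x j 0 = ((c - u *m A) *m x) 0 0.
  by rewrite [RHS]mxE; apply: eq_bigr => j _; rewrite colE mulmxA -colE !mxE.
have -> : \sum_p u 0 p * ((row p A *m x) 0 0 - b p 0) = (u *m (A *m x - b)) 0 0.
  by rewrite [RHS]mxE; apply: eq_bigr => p _; rewrite -row_mul !mxE.
rewrite mulmxBl mulmxBr mulmxA.
have sub (M N : 'M[R]_1) : (M - N) 0 0 = M 0 0 - N 0 0 by rewrite !mxE.
by rewrite !sub addrA subrK.
Qed.

Lemma weak_duality (R : realType) (m d : nat) (A : 'M[R]_(m, d))
    (b : 'cV[R]_m) (c : 'rV[R]_d) (x : 'cV[R]_d) (u : 'rV[R]_m) :
  primal_feasible A b x -> dual_feasible A c u ->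
  (u *m b) 0 0 <= (c *m x) 0 0.
Proof.
move=> [Ax x0] [uA u0].
have /mxle_subr0 Ax0 := Ax; have /mxle_subr0 uA0 := uA.
have := mulmx_ge0 u0 Ax0 0 0; have := mulmx_ge0 uA0 x0 0 0.
rewrite mulmxBl mulmxBr mulmxA !mxE !subr_ge0 => le1 le2.
exact: le_trans le2 le1.
Qed.

Section excluded_slackness.
Variables (R : realType) (m d : nat) (A : 'M[R]_(m, d)) (b : 'cV[R]_m).
Variables (c : 'rV[R]_d) (k : 'I_d) (x : 'cV[R]_d) (u : 'rV[R]_m).
Hypotheses (xP : primal_feasible_at A b k x) (uD : dual_feasible A c u).

Let column_ge0 j : 0 <= (c 0 j - (u *m col j A) 0 0) * x j 0.
Proof.
apply: mulr_ge0; last by have := xP.1.2 j 0; rewrite mxE.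
by rewrite subr_ge0 colE mulmxA -colE mxE uD.1.
Qed.

Let row_ge0 p : 0 <= u 0 p * ((row p A *m x) 0 0 - b p 0).
Proof.
apply: mulr_ge0; first by have := uD.2 0 p; rewrite mxE.
by rewrite subr_ge0 -row_mul mxE xP.1.1.
Qed.

(** As [x_k = 1], column [k] contributes exactly its reduced cost to the duality gap; all other
    terms are nonnegative. *)
Lemma reduced_cost_le : reduced_cost A c u k <= (c *m x) 0 0 - (u *m b) 0 0.
Proof.
rewrite (duality_gap A b c k) xP.2 mulr1 lerDl.
by apply: addr_ge0; apply: sumr_ge0.
Qed.

(** The equality case of [reduced_cost_le]: a sum of nonnegative products vanishes only if each
    product has a zero factor. *)
Lemma reduced_cost_eq :
  reduced_cost A c u k = (c *m x) 0 0 - (u *m b) 0 0 <->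
  excluded_slackness A b c k x u.
Proof.
rewrite (duality_gap A b c k) xP.2 mulr1; split=> [/eqP|[cols rows]].
  rewrite -subr_eq0 opprD addrA subrr sub0r oppr_eq0.
  rewrite paddr_eq0 ?sumr_ge0// !psumr_eq0//.
  move=> /andP[/allP cols /allP rows]; split=> [j jk|p].
    have := cols j (mem_index_enum _); rewrite jk /= mulf_eq0 subr_eq0.
    by move=> /orP[/eqP->|/eqP->]; [left|right].
  have := rows p (mem_index_enum _); rewrite /= mulf_eq0 subr_eq0.
  by move=> /orP[/eqP->|/eqP->]; [right|left].
rewrite !big1 ?addr0//.
  by move=> p _; case: (rows p) => ->; rewrite ?subrr ?mulr0 ?mul0r.
by move=> j jk; case: (cols j jk) => ->; rewrite ?subrr ?mulr0 ?mul0r.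
Qed.

End excluded_slackness.

(** * Attainment of the minima *)

(** A least value is unique, so [xget] returns it rather than its default. *)
Lemma min_costE (R : realType) (d : nat) (c : 'rV[R]_d) (X : set 'cV[R]_d) x :
  X x -> (forall y, X y -> (c *m x) 0 0 <= (c *m y) 0 0) ->
  min_cost c X = (c *m x) 0 0.
Proof.
move=> Xx xmin; apply: xget_unique => [|_ [[y Xy <-] ylb]].
  by split=> [|_ [y Xy <-]]; [exists x|exact: xmin].
by apply: le_anti; rewrite xmin// andbT; apply: ylb; exists x.
Qed.

(* The set of [x] with [e x < w], or [e x = w] and [z <= c x], is convex. *)
Lemma convex_hull_face_le (R : realType) (d : nat) (X : set 'cV[R]_d)
    (c e : 'rV[R]_d) (w z : R) :
  (forall x, X x -> (e *m x) 0 0 <= w) ->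
  (forall x, X x -> (e *m x) 0 0 = w -> z <= (c *m x) 0 0) ->
  forall x, convex_hull X x -> (e *m x) 0 0 = w -> z <= (c *m x) 0 0.
Proof.
move=> eX cX.
pose Y : set 'cV[R]_d :=
  [set x | (e *m x) 0 0 < w \/ (e *m x) 0 0 = w /\ z <= (c *m x) 0 0].
suff sub : convex_hull X `<=` Y.
  by move=> x /sub[lt eq|[]//]; rewrite eq ltxx in lt.
apply: smallest_sub => [|x Xx]; last first.
  by have := eX _ Xx; rewrite le_eqVlt => /predU1P[eq|]; [right; split; auto|left].
apply/convex_setW => x y; rewrite !inE => Yx Yy t t0 t1; rewrite inE.
have lin (f : 'rV[R]_d) : (f *m (conv t x y : 'cV[R]_d)) 0 0
    = t%:num * (f *m x) 0 0 + (1 - t%:num) * (f *m y) 0 0.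
  rewrite [conv t x y : 'cV_d](_ : _ = t%:num *: x + (1 - t%:num) *: y)//.
  by rewrite mulmxDr -!scalemxAr [LHS]mxE; congr (_ + _); rewrite mxE.
have t1' : 0 < 1 - t%:num by rewrite subr_gt0.
have split_t r : r = t%:num * r + (1 - t%:num) * r.
  by rewrite mulrBl mul1r addrC subrK.
rewrite /Y /= !lin.
(* Both weights are positive, so one strict inequality puts the combination strictly below [w];
   otherwise the two bounds by [z] average. *)
case: Yx Yy => [ltx|[eqx zx]] [lty|[eqy zy]].
- by left; rewrite [ltRHS]split_t ltrD// ltr_pM2l.
- by left; rewrite [ltRHS]split_t eqy ltrD2r ltr_pM2l.
- by left; rewrite [ltRHS]split_t eqx ltrD2l ltr_pM2l.
- right; rewrite eqx eqy -split_t; split=> //.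
  by rewrite (split_t z) lerD// ler_pM2l.
Qed.

(* A characteristic vector is determined by its Boolean entries, so there are
   finitely many of them even though [C] may be infinite. *)
Lemma char_vecs_min (R : realType) (n : nat) (D : 'I_n -> {fset int})
    (C : set (n.-tuple int)) (P : set 'cV[R]_#|vvpair D|)
    (f : 'cV[R]_#|vvpair D| -> R) x :
  char_vecs R D C x -> P x ->
  exists y, [/\ char_vecs R D C y, P y &
    forall y', char_vecs R D C y' -> P y' -> f y <= f y'].
Proof.
move=> Sx Px.
pose bvec (g : {ffun 'I_#|vvpair D| -> bool}) : 'cV[R]_#|vvpair D| :=
  \col_j (g j)%:R.
have bvecP y : char_vecs R D C y -> exists g, y = bvec g.
  move=> [a _ <-].
  exists [ffun j => tnth a (pvar (enum_val j)) == pval (enum_val j)].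
  by apply/colP => j; rewrite !mxE ffunE.
pose Q g := `[< char_vecs R D C (bvec g) /\ P (bvec g) >].
have [g0 xg0] := bvecP x Sx.
have Qg0 : Q g0 by apply/asboolP; rewrite -xg0.
case: (arg_minP (fun g => f (bvec g)) Qg0) => g /asboolP[Sg Pg] gmin.
exists (bvec g); split=> // y Sy Py; have [h yh] := bvecP y Sy.
by rewrite yh; apply: gmin; apply/asboolP; rewrite -yh.
Qed.

(** A cheapest characteristic vector on the face is a minimizer on the whole face, by
    [convex_hull_face_le]. *)
Lemma convex_hull_face_min (R : realType) (n : nat) (D : 'I_n -> {fset int})
    (C : set (n.-tuple int)) (c e : 'rV[R]_#|vvpair D|) (w : R) s :
  (forall x, char_vecs R D C x -> (e *m x) 0 0 <= w) ->
  char_vecs R D C s -> (e *m s) 0 0 = w ->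
  exists x, [/\ convex_hull (char_vecs R D C) x, (e *m x) 0 0 = w &
    forall y, convex_hull (char_vecs R D C) y -> (e *m y) 0 0 = w ->
      (c *m x) 0 0 <= (c *m y) 0 0].
Proof.
move=> eS Ss es.
have [x [Sx ex xmin]] := char_vecs_min (P := [set x | (e *m x) 0 0 = w])
  (fun x => (c *m x) 0 0) Ss es.
exists x; split=> //; first exact: sub_gen_smallest.
exact: convex_hull_face_le.
Qed.

Theorem corollary1 (R : realType) (n : nat) (D : 'I_n -> {fset int})
  (C : set (n.-tuple int)) (c : vvpair D -> int)
  (m : nat) (A : 'M[R]_(m, #|vvpair D|)) (b : 'cV[R]_m)
  (ideal : primal_feasible A b = convex_hull (char_vecs R D C))
  (feasibility : forall ij : vvpair D,
     exists2 a, supports D C a & tnth a (pvar ij) = pval ij)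
  (u : 'rV[R]_m) (u_opt : dual_optimal A b (cost_vec R c) u)
  (kl : vvpair D) :
  reduced_cost A (cost_vec R c) u (enum_rank kl)
    = exact_reduced_cost A b (cost_vec R c) (enum_rank kl)
  <->
  exists2 x : 'cV[R]_#|vvpair D|,
    primal_feasible_at A b (enum_rank kl) x &
    excluded_slackness A b (cost_vec R c) (enum_rank kl) x u.
Proof.
have [uD umax] := u_opt; set k := enum_rank kl; set cv := cost_vec R c in uD umax *.
have [a Ca akl] := feasibility kl.
have Sa : char_vecs R D C (char_vec R D a) by exists a.
have coord (x : 'cV[R]_#|vvpair D|) : ((delta_mx 0 k : 'rV_ _) *m x) 0 0 = x k 0.
  by rewrite -rowE mxE.
(* With [e = 0] and [w = 0] the face is the entire hull. *)
have [||x [Px _ xmin]] := @convex_hull_face_min R n D C cv 0 0 _ _ Sa.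
- by move=> y _; rewrite mul0mx mxE.
- by rewrite mul0mx mxE.
(* Entries of characteristic vectors are at most 1, so [x_kl = 1] cuts out a face; the support [a]
   through [kl] makes it nonempty. *)
have [||x' [Px' x'k x'min]] :=
    @convex_hull_face_min R n D C cv (delta_mx 0 k) 1 _ _ Sa.
- by move=> _ [a' _ <-]; rewrite coord mxE lern1 leq_b1.
- by rewrite coord mxE enum_rankK akl eqxx.
rewrite -ideal in Px Px' xmin x'min; rewrite coord in x'k.
have {}xmin y : primal_feasible A b y -> (cv *m x) 0 0 <= (cv *m y) 0 0.
  by move=> Py; apply: xmin => //; rewrite mul0mx mxE.
have {}x'min y : primal_feasible_at A b k y -> (cv *m x') 0 0 <= (cv *m y) 0 0.
  by move=> [Py yk]; apply: x'min => //; rewrite coord.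
have Px'k : primal_feasible_at A b k x' by [].
have ub : (u *m b) 0 0 = (cv *m x) 0 0.
  have [v vD xv] := strong_duality Px xmin.
  by apply: le_anti; rewrite (weak_duality Px uD) (le_trans xv)// umax.
rewrite /exact_reduced_cost (min_costE Px'k x'min) (min_costE Px xmin) -ub.
(* Forward, the minimizer [x'] is the witness. Backward, the reduced cost equals
   [c y - u b >= c x' - u b], and [reduced_cost_le] at [x'] gives the other inequality. *)
split=> [/(reduced_cost_eq Px'k uD)|[y Py /(reduced_cost_eq Py uD) ry]].
  by exists x'.
by apply: le_anti; rewrite reduced_cost_le//= ry lerD2r x'min.
Qed.
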